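(* For a fixed real number $x_0$, consider the evaluation map which sends each vertex $p(x)/q(x)$ of the Farey polynomial tree to the value $p(x_0)/q(x_0)$. Then: (1) For every real $x_0>0$, the evaluation map at $x_0$ is injective on the set of vertices of the tree, and its image is a dense subset of $(0,1)$. (2) For real $x_0>0$, the evaluation map at $x_0$ is a bijection from the set of vertices of the tree onto $\mathbb{Q}\cap(0,1)$ if and only if $x_0\in\mathbb{Z}^+$.
   Context: The Farey polynomial tree is the infinite rooted binary tree whose nodes carry rational functions $p(x)/q(x)$ (with $p,q$ polynomials), whose root is $\frac{x}{x+1}$, and where the node carrying $p/q$ has two children $\Phi_0(p/q)$ and $\Phi_1(p/q)$ given by $$\Phi_0\left(\frac{p(x)}{q(x)}\right)=\begin{cases}\dfrac{x\,q(x)}{x\,q(x)+p(x)} & p(0)\neq 0,\\[2ex] \dfrac{q(x)}{q(x)+p(x)/x} & p(0)=0,\end{cases}\qquad \Phi_1\left(\frac{p(x)}{q(x)}\right)=\begin{cases}\dfrac{x\,p(x)}{x\,q(x)+p(x)} & p(0)\neq 0,\\[2ex] \dfrac{p(x)}{q(x)+p(x)/x} & p(0)=0.\end{cases}$$ Vertices are the nodes of this binary tree: injectivity means that distinct nodes give distinct values. $\mathbb{Z}^+$ is the set of positive integers. *)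

(* Defs.v *)
From HB Require Import structures.
From mathcomp Require Import all_boot all_order all_algebra.
From mathcomp Require Import all_classical all_reals all_analysis.
Set Implicit Arguments.
Unset Strict Implicit.
Unset Printing Implicit Defensive.
Import Order.TTheory GRing.Theory Num.Theory.
Import numFieldNormedType.Exports.
Local Open Scope ring_scope.
Local Open Scope classical_set_scope.

Section Farey.
Variable R : realType.

(* A rational function p/q is given by the pair (p, q): the case distinction
   on p(0) in Phi0 and Phi1 refers to the fraction as written, which quotienting
   into the field of fractions would forget. *)
Definition ratfun : Type := ({poly R} * {poly R})%type.

Definition Phi0 (r : ratfun) : ratfun :=
  let: (p, q) := r in
  if p.[0] != 0 then ('X * q, 'X * q + p) else (q, q + p %/ 'X).

Definition Phi1 (r : ratfun) : ratfun :=
  let: (p, q) := r in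
  if p.[0] != 0 then ('X * p, 'X * q + p) else (p, q + p %/ 'X).

Definition farey_root : ratfun := ('X, 'X + 1).

(* A node of the infinite binary tree is the word of branchings leading to it
   from the root, read left to right; its children are rcons w false (Phi0) and
   rcons w true (Phi1). *)
Definition farey_node := seq bool.

Definition farey_label (w : farey_node) : ratfun :=
  foldl (fun r b => if b then Phi1 r else Phi0 r) farey_root w.

Definition farey_eval (x0 : R) (w : farey_node) : R :=
  (farey_label w).1.[x0] / (farey_label w).2.[x0].

Definition dense_subset (S U : set R) : Prop :=
  S `<=` U /\ U `<=` closure S.

End Farey.

(* Main.v *)
(* At a fixed x > 0 the two branches become y |-> x / (x + y) and
   y |-> x y / (x + y), whatever p(0) is; they map (0, 1) injectively onto
   (x / (x + 1), 1) and (0, x / (x + 1)), and the root value x / (x + 1) is what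
   is left over, whence injectivity.  Iterating the second branch k times after
   the first one gives y |-> x / (x + k + y), so that every t in (0, 1) has a
   continued fraction expansion with numerators x.  Two such steps contract
   distances by (1 + x)^-2, whence density.  For x a positive integer the
   expansion of a rational is a Euclidean algorithm, so it terminates.  If x = m / d
   in lowest terms, all values are fractions with numerator and denominator
   coprime to d, so that 1 / d is missed unless d = 1. *)
Require Import Defs.
From HB Require Import structures.
From mathcomp Require Import all_boot all_order all_algebra.
From mathcomp Require Import all_classical all_reals all_analysis.
From mathcomp Require Import ring lra.
Import Order.TTheory GRing.Theory Num.Theory.
Import numFieldNormedType.Exports.
Local Open Scope ring_scope.
Local Open Scope classical_set_scope.

(** A zero at 0 makes the division by ['X] exact, so no remainder disturbs the value. *)
Lemma horner_divX (F : fieldType) (p : {poly F}) (x : F) :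
  p.[0] = 0 -> x != 0 -> (p %/ 'X).[x] = p.[x] / x.
Proof.
move=> p0 x0.
have dvdXp : 'X %| p by rewrite -['X]subr0 -polyC0 dvdp_XsubCl /root p0.
by rewrite -[in RHS](divpK dvdXp) hornerM hornerX mulfK.
Qed.

(** * Recursion of the values along the tree, and injectivity *)

Section Values.
Variables (R : realType) (x : R).
Hypothesis x_gt0 : 0 < x.

Let branch (b : bool) (y : R) := if b then x * y / (x + y) else x / (x + y).

(** The two cases of [Phi0] and [Phi1] differ at [x] only by a common factor, [c = 1] or [c = x],
    which cancels in the value. *)
Lemma farey_label_rcons_horner w b (p := (farey_label R w).1.[x])
    (q := (farey_label R w).2.[x]) :
  exists2 c : R, 0 < c &
    (farey_label R (rcons w b)).1.[x] = c * (if b then p else q) /\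
    (farey_label R (rcons w b)).2.[x] = c * (q + p / x).
Proof.
rewrite {}/p {}/q [farey_label R (rcons w b)]foldl_rcons -/(farey_label R w).
have x0 : x != 0 by rewrite gt_eqF.
case: (farey_label R w) => p q.
have [p0|p0] := eqVneq p.[0] 0.
  by exists 1 => //; case: b; rewrite /= p0 eqxx /= !hornerE horner_divX ?mul1r.
exists x => //; case: b; rewrite /= p0 /= !hornerE; split=> //; field.
all: by [].
Qed.

Lemma farey_label_gt0 w :
  0 < (farey_label R w).1.[x] /\ 0 < (farey_label R w).2.[x].
Proof.
elim/last_ind: w => [|w b [p0 q0]].
  by rewrite /farey_label /farey_root /= !hornerE addr_gt0.
have [c c0 [-> ->]] := farey_label_rcons_horner w b.
by case: b; rewrite !mulr_gt0 // addr_gt0 // divr_gt0.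
Qed.

Lemma farey_eval_nil : farey_eval x [::] = x / (x + 1).
Proof. by rewrite /farey_eval /farey_label /farey_root /= !hornerE. Qed.

Lemma farey_eval_gt0 w : 0 < farey_eval x w.
Proof. by have [p0 q0] := farey_label_gt0 w; rewrite divr_gt0. Qed.

Lemma farey_eval_rcons w b :
  farey_eval x (rcons w b) = branch b (farey_eval x w).
Proof.
have [p0 q0] := farey_label_gt0 w.
rewrite /farey_eval /branch.
have [c c0 [-> ->]] := farey_label_rcons_horner w b.
set p := (farey_label R w).1.[x] in p0 *; set q := (farey_label R w).2.[x] in q0 *.
have ? : x * q + p != 0 by rewrite gt_eqF// addr_gt0// mulr_gt0.
have ? : q * x + p != 0 by rewrite mulrC.
by case: b; field; rewrite ?gt_eqF//= ?(mulrC q) ?(addrC p) ?gt_eqF// addr_gt0// mulr_gt0.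
Qed.

Lemma branch_itv b (y : R) : 0 < y < 1 ->
  if b then 0 < branch b y < x / (x + 1) else x / (x + 1) < branch b y < 1.
Proof.
have x0 := x_gt0; move=> /andP[y0 y1]; rewrite /branch.
have xy0 : 0 < x + y by lra.
have x10 : 0 < x + 1 by lra.
case: b; apply/andP; split.
- by rewrite divr_gt0// mulr_gt0.
- have ? : 0 < x * x * (1 - y) by rewrite !mulr_gt0// subr_gt0.
  by rewrite ltr_pdivrMr// mulrAC ltr_pdivlMr//; nra.
- by rewrite ltr_pdivrMr// mulrAC ltr_pdivlMr//; nra.
- by rewrite ltr_pdivrMr//; lra.
Qed.

Lemma branch_inj b y z : 0 < y -> 0 < z -> branch b y = branch b z -> y = z.
Proof.
move=> y0 z0; rewrite /branch.
have xy0 : x + y != 0 by rewrite gt_eqF// addr_gt0.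
have xz0 : x + z != 0 by rewrite gt_eqF// addr_gt0.
case: b => /eqP; rewrite eqr_div// => /eqP.
  (* After cross-multiplication the terms [x * y * z] cancel, leaving [x * x * y = x * x * z]. *)
  have : 0 < x * x by rewrite mulr_gt0.
  by move=> xx0 e; apply: (mulfI (lt0r_neq0 xx0)); nra.
by move=> /(mulfI (lt0r_neq0 x_gt0)) /addrI.
Qed.

Lemma farey_eval_itv w : 0 < farey_eval x w < 1.
Proof.
have x0 := x_gt0; elim/last_ind: w => [|w b IH].
  by rewrite farey_eval_gt0 farey_eval_nil ltr_pdivrMr; lra.
rewrite farey_eval_gt0 farey_eval_rcons /=.
have := branch_itv b _ IH; case: b => /andP[_] // /lt_trans; apply.
by rewrite ltr_pdivrMr; lra.
Qed.

(** The value tells the last letter by its side of [x / (x + 1)], a point reached by the empty word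
    only; stripping that letter gives the induction. *)
Lemma farey_eval_inj : injective (farey_eval x).
Proof.
have branch_nil w b : farey_eval x (rcons w b) != farey_eval x [::].
  rewrite farey_eval_rcons farey_eval_nil; have := branch_itv b _ (farey_eval_itv w).
  by case: b => /andP[? ?]; rewrite neq_lt; apply/orP; [left|right].
elim/last_ind => [|w b IH] v; case/lastP: v => [|v c] //.
- by move=> /esym/eqP; rewrite (negPf (branch_nil _ _)).
- by move=> /eqP; rewrite (negPf (branch_nil _ _)).
rewrite !farey_eval_rcons.
have Bw := branch_itv b _ (farey_eval_itv w).
have Bv := branch_itv c _ (farey_eval_itv v).
have [<-|] := eqVneq b c.
  by move=> /branch_inj e; rewrite (IH _ (e (farey_eval_gt0 _) (farey_eval_gt0 _))).
move=> bc e; exfalso; move: bc Bw Bv; rewrite e.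
by case: b {e}; case: c => // _; lra.
Qed.

(** * Continued fractions with numerators [x], and density *)

Local Notation S := (range (farey_eval x)).

Lemma range_branch b y : S y -> S (branch b y).
Proof. by move=> [w _ <-]; exists (rcons w b); rewrite ?farey_eval_rcons. Qed.

(** The second branch sends [x / z] to [x / (z + 1)]. *)
Lemma range_iter_branch1 (k : nat) (z : R) :
  0 < z -> S (x / z) -> S (x / (z + k%:R)).
Proof.
move=> z0 Sz; elim: k => [|k IH]; first by rewrite addr0.
have := range_branch true _ IH; rewrite /branch; congr (S _).
have zk : 0 < z + k%:R by rewrite ltr_wpDr.
have zk1 : 0 < z + k%:R + 1 by rewrite addr_gt0.
rewrite -[k.+1%:R]natr1 addrA; field.
by rewrite !gt_eqF// addr_gt0// mulr_gt0.
Qed.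

(** Here an expansion ends. The root already has digit 1, so a final digit is never 0. *)
Lemma range_root_digit (k : nat) : S (x / (x + k.+1%:R)).
Proof.
rewrite -natr1 (addrC k%:R) addrA; apply: range_iter_branch1.
  by rewrite addr_gt0.
by exists [::] => //; rewrite farey_eval_nil.
Qed.

Lemma range_digit (k : nat) (y : R) : S y -> S (x / (x + k%:R + y)).
Proof.
move=> Sy; rewrite addrAC; apply: range_iter_branch1.
  by case: Sy => w _ <-; rewrite addr_gt0// farey_eval_gt0.
exact: (range_branch false).
Qed.

Lemma range_digit_cases (t : R) : 0 < t < 1 ->
  S t \/ exists (k : nat) (u : R), 0 < u < 1 /\ t = x / (x + k%:R + u).
Proof.
have x0 := x_gt0; move=> /andP[t0 t1].
have xt : x <= x / t by rewrite ler_pdivlMr//; nra.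
have xt' : x < x / t by rewrite ltr_pdivlMr//; nra.
have /truncn_itv : 0 <= x / t - x by rewrite subr_ge0.
(* The digit [k] is the integer part of [x / t - x], and [u] the fractional part. If the latter
   vanishes, [k = 0] would force [t = 1]. *)
set k := Num.truncn _ => /andP[]; rewrite le_eqVlt => /orP[/eqP ek _|ku uk].
  left; have -> : t = x / (x + k%:R) by rewrite ek addrC subrK invf_div mulrCA divff ?mulr1 ?gt_eqF.
  case: k ek => [|k] ek; last exact: range_root_digit.
  by move: ek; rewrite /=; lra.
right; exists k, (x / t - x - k%:R); split.
  by move: uk; rewrite -natr1; lra.
have -> : x + k%:R + (x / t - x - k%:R) = x / t by ring.
by rewrite invf_div mulrCA divff ?mulr1 ?gt_eqF.
Qed.

(** One digit may expand distances: for [k = 0] the slope at 0 is [- 1 / x]. Over two digits,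
    clearing the inner fraction gives the denominator [D y], at least [x * (1 + x)], and the
    difference is [(v - s) * x ^+ 2 / (D v * D s)]. *)
Lemma two_digits_contract (k l : nat) (v s : R) : 0 <= v -> 0 <= s ->
  `|x / (x + k%:R + x / (x + l%:R + v)) - x / (x + k%:R + x / (x + l%:R + s))|
    <= `|v - s| / (1 + x) ^+ 2.
Proof.
move=> v0 s0; have x0 := x_gt0.
pose D y := (x + k%:R) * (x + l%:R + y) + x.
have k0 : 0 <= k%:R :> R by [].
have l0 : 0 <= l%:R :> R by [].
move: k0 l0; rewrite /D; set K := k%:R; set L := l%:R => k0 l0.
have DE y : 0 <= y -> x * (1 + x) <= D y by rewrite /D -/K -/L; nra.
have x1 : 0 < x * (1 + x) by nra.
have Dv := DE _ v0; have Ds := DE _ s0.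
have Dv0 := lt_le_trans x1 Dv; have Ds0 := lt_le_trans x1 Ds.
have -> : x / (x + K + x / (x + L + v)) - x / (x + K + x / (x + L + s)) =
    (v - s) * (x ^+ 2 / (D v * D s)).
  have Lv : x + L + v != 0 by rewrite gt_eqF//; lra.
  have Ls : x + L + s != 0 by rewrite gt_eqF//; lra.
  move: Dv0 Ds0 => /lt0r_neq0 + /lt0r_neq0; rewrite /D -/K -/L => Dv0 Ds0.
  by field; rewrite Lv Ls Dv0 Ds0.
rewrite normrM ler_wpM2l// ger0_norm; last by rewrite divr_ge0 ?sqr_ge0 ?mulr_ge0 ?ltW.
rewrite ler_pdivrMr ?mulr_gt0// mulrC ler_pdivlMr; last by rewrite exprn_gt0//; lra.
by rewrite -exprMn expr2 ler_pM// ltW.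
Qed.

(** Each induction step peels two digits off [t]; if the expansion stops early, [t] itself is a
    value. *)
Lemma farey_eval_approx n (t : R) : 0 < t < 1 ->
  exists2 s, S s & `|t - s| <= (1 + x) ^- (2 * n).
Proof.
have x0 := x_gt0; elim: n t => [|n IH] t t01.
  exists (farey_eval x [::]); first by exists [::].
  rewrite muln0 expr0 invr1 ler_norml; have := farey_eval_itv [::]; lra.
have x1n m : 0 <= (1 + x) ^- m by rewrite invr_ge0 exprn_ge0//; lra.
have [St|[k [u [u01 ->]]]] := range_digit_cases _ t01.
  by exists t; rewrite ?subrr ?normr0.
have [Su|[l [v [v01 ->]]]] := range_digit_cases _ u01.
  by exists (x / (x + k%:R + u)); rewrite ?subrr ?normr0//; exact: range_digit.
have [s Ss vs] := IH v v01.
exists (x / (x + k%:R + x / (x + l%:R + s))).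
  by do 2! apply: range_digit.
have s0 : 0 <= s by case: Ss => w _ <-; rewrite ltW// farey_eval_gt0.
have v0 : 0 <= v by lra.
apply: le_trans (two_digits_contract k l _ _ v0 s0) _.
have -> : (1 + x) ^- (2 * n.+1) = (1 + x) ^- (2 * n) / (1 + x) ^+ 2.
  by rewrite mulnSr exprD invfM.
exact: ler_wpM2r.
Qed.

Lemma farey_eval_dense : dense_subset S `]0, 1[.
Proof.
have x0 := x_gt0; split=> [_ [w _ <-]|t]; first by rewrite /= in_itv /= farey_eval_itv.
rewrite /= in_itv /= => t01 B /nbhs_ballP[e /= e0 eB].
have c1 : `|(1 + x) ^- 2| < 1.
  rewrite ger0_norm; last by rewrite invr_ge0 exprn_ge0//; lra.
  by rewrite invf_lt1 ?exprn_gt0 ?exprn_egt1//; lra.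
have /cvgrPdist_lt /(_ _ e0)[n _ /(_ n (leqnn n))] := cvg_expr c1.
rewrite /= sub0r normrN exprVn -exprM => /(le_lt_trans (ler_norm _)) ne.
have [s Ss ts] := farey_eval_approx n _ t01.
by exists s; split=> //; apply: eB; exact: le_lt_trans ts ne.
Qed.

End Values.

(** * Rational values *)

Lemma range_farey_eval_nat (R : realType) (n : nat) : (0 < n)%N ->
  forall b a : nat, (0 < a < b)%N ->
  range (farey_eval (n%:R : R)) (a%:R / b%:R).
Proof.
move=> n0; elim/ltn_ind => b IH a /andP[a0 ab].
have nR : 0 < n%:R :> R by rewrite ltr0n.
have aR : a%:R != 0 :> R by rewrite pnatr_eq0 -lt0n.
have bR : b%:R != 0 :> R by rewrite pnatr_eq0 -lt0n (ltn_trans a0).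
(* Euclidean division of [n * (b - a)] by [a] yields the digit [k] and the tail [r / a], whose
   denominator is smaller than [b]. *)
have [k [r [ra E]]] : exists k r : nat,
    (r < a)%N /\ n%:R * (b%:R - a%:R) = k%:R * a%:R + r%:R :> R.
  exists (n * (b - a) %/ a)%N, (n * (b - a) %% a)%N; split; first exact: ltn_pmod.
  by rewrite -natrB ?(ltnW ab)// -!natrM -natrD -divn_eq.
have -> : a%:R / b%:R = n%:R / (n%:R + k%:R + r%:R / a%:R) :> R.
  have -> : n%:R + k%:R + r%:R / a%:R = n%:R * b%:R / a%:R :> R.
    apply: (mulIf aR); rewrite mulrDl !divfK//.
    by move: E; rewrite mulrBr => E; lra.
  by field; rewrite aR bR gt_eqF.
have [r0|r0] := posnP r; last first.
  by apply: range_digit => //; apply: IH => //; rewrite r0.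
rewrite r0 mul0r addr0.
have : (0 < k)%N.
  rewrite lt0n; apply/eqP => k0; move: E; rewrite k0 r0 mul0r addr0 => /eqP.
  by rewrite mulf_eq0 gt_eqF// subr_eq0 eqr_nat (gtn_eqF ab).
by case: k {E} => // k _; exact: range_root_digit.
Qed.

Lemma ratr_posE (R : realType) (t : R) : 0 < t -> range (@ratr R) t ->
  exists m d : nat, [/\ (0 < m)%N, (0 < d)%N, coprime m d & t = m%:R / d%:R].
Proof.
move=> t0 [q _ qt]; move: t0; rewrite -qt ltr0q => q0.
exists `|numq q|%N, `|denq q|%N; split.
- by rewrite absz_gt0 numq_eq0 gt_eqF.
- by rewrite absz_gt0 denq_neq0.
- exact: coprime_num_den.
- rewrite /ratr !natr_absz !gtr0_norm ?numq_gt0//.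
Qed.

(** The branches send [a / b] to [m * a] or [m * b] over [m * b + d * a], and this denominator is
    [m * b] modulo [d]. The fraction need not be reduced. *)
Lemma farey_eval_coprime (R : realType) (m d : nat) (x := m%:R / d%:R : R) w :
  (0 < m)%N -> (0 < d)%N -> coprime m d ->
  exists a b : nat, [/\ (0 < b)%N, coprime d a, coprime d b &
    farey_eval x w = a%:R / b%:R].
Proof.
move=> m0 d0 md.
have dm : coprime d m by rewrite coprime_sym.
have mR : 0 < m%:R :> R by rewrite ltr0n.
have dR : 0 < d%:R :> R by rewrite ltr0n.
have x0 : 0 < x by rewrite divr_gt0.
elim/last_ind: w => [|w c [a [b [b0 da db E]]]].
  exists m, (m + d)%N; split; rewrite ?addn_gt0 ?m0 /coprime ?gcdnDr//.
  by rewrite farey_eval_nil // natrD /x; field; rewrite !gt_eqF//= addr_gt0.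
exists (m * (if c then a else b))%N, (m * b + d * a)%N; split.
- by rewrite addn_gt0 muln_gt0 m0 b0.
- by case: c; rewrite coprimeMr dm.
- by rewrite /coprime addnC (mulnC d) gcdnMDl -/(coprime _ _) coprimeMr dm.
have bR : 0 < b%:R :> R by rewrite ltr0n.
rewrite farey_eval_rcons// E natrD !natrM /x.
have D : 0 < m%:R * b%:R + d%:R * a%:R :> R by rewrite ltr_wpDr ?mulr_ge0 ?mulr_gt0.
by case: c; field; rewrite ?(gt_eqF D) !gt_eqF//.
Qed.

Theorem theorem1p1 (R : realType) :
  (forall x0 : R, 0 < x0 ->
     injective (farey_eval x0) /\
     dense_subset (range (farey_eval x0)) `]0, 1[) /\
  (forall x0 : R, 0 < x0 ->
     (set_bij [set: farey_node] (range (@ratr R) `&` `]0, 1[) (farey_eval x0)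
      <-> exists n : nat, (0 < n)%N /\ x0 = n%:R)).
Proof.
split=> x x0.
  by split; [exact: farey_eval_inj|exact: farey_eval_dense].
split=> [[fS _ surj]|[n [n0 xn]]].
  have [[q _ qE] _] := fS [::] I.
  (* The root value [q = x / (x + 1)] is rational, and [x = q / (1 - q)]. *)
  have xQ : range (@ratr R) x.
    exists (q / (1 - q)) => //.
    rewrite fmorph_div/= rmorphB/= rmorph1 qE farey_eval_nil.
    by field; rewrite !gt_eqF//; lra.
  have [m [d [m0 d0 md xE]]] := ratr_posE _ _ x0 xQ.
  have [d1|d1] := leqP d 1.
    by exists m; split=> //; rewrite xE (_ : d = 1%N) ?divr1//; case: d d0 d1 {md xE} => [|[]].
  have [w _ wE] : range (farey_eval x) (d%:R^-1).
    apply: surj; split.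
      by exists (d%:R^-1) => //; rewrite fmorphV/= rmorph_nat.
    by rewrite /= in_itv/= invr_gt0 ltr0n d0 invf_lt1 ?ltr0n// ltr1n.
  have [a [b [b0 _ db]]] := farey_eval_coprime R _ _ w m0 d0 md.
  rewrite -xE wE => E.
  (* From [a / b = 1 / d] it follows that [d] divides [b], against coprimality since [d > 1]. *)
  have bE : b = (a * d)%N.
    apply/eqP; rewrite -(eqr_nat R) natrM.
    have bR : b%:R != 0 :> R by rewrite pnatr_eq0 -lt0n.
    have dR : d%:R != 0 :> R by rewrite pnatr_eq0 -lt0n.
    by apply/eqP/(mulIf (invr_neq0 bR)); rewrite divff// mulrAC -E mulVf.
  by move: db; rewrite bE coprimeMr /coprime gcdnn (gtn_eqF d1) andbF.
rewrite xn; have nR : 0 < n%:R :> R by rewrite ltr0n.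
split.
- move=> w _; split; last by rewrite /= in_itv/= farey_eval_itv.
  (* With [d = 1] coprimality is vacuous; what remains is that the value is a quotient of
     naturals. *)
  have := @farey_eval_coprime R n 1 w n0 isT (coprimen1 n).
  rewrite divr1 => -[a [b [_ _ _ ->]]].
  by exists (a%:R / b%:R) => //; rewrite fmorph_div/= !rmorph_nat.
- by move=> v w _ _; exact: farey_eval_inj.
- move=> t [tQ]; rewrite /= in_itv/= => /andP[t0 t1].
  have [a [b [a0 b0 _ tE]]] := ratr_posE _ _ t0 tQ.
  rewrite tE; apply: range_farey_eval_nat => //.
  by move: t1; rewrite a0 tE ltr_pdivrMr ?ltr0n// mul1r ltr_nat.
Qed.
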